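(* Let $T$ be the tree with vertex set $\{1,2,3,4,5\}$ and edge set $\{13,\,53,\,32,\,24\}$, and let $T_1$ be the tree with vertex set $\{1,2,3,4,5,c\}$ and edge set $\{1c,\,5c,\,c2,\,23,\,34\}$. Let $G$ be a graph such that $I(G;x)$ has only real zeros. Then: (i) the independence polynomial $I(G\overline{\circ}T;x)$ of the rooted product of $G$ and $T$ with respect to the root $v$ has only real zeros when $v\in\{1,2,3\}$, and it is log-concave when $v=4$; (ii) the independence polynomial $I(G\overline{\circ}T_1;x)$ of the rooted product of $G$ and $T_1$ with respect to the root $v$ is log-concave for each $v\in\{1,2,3,4\}$.
   Context: All graphs are finite and simple. An independent set of a graph $G$ is a set of pairwise non-adjacent vertices; $\alpha(G)$ is the size of a largest independent set. The independence polynomial is $I(G;x)=\sum_{k=0}^{\alpha(G)}i_k(G)x^k$, where $i_k(G)$ is the number of independent sets of cardinality $k$ in $G$ and $i_0(G)=1$. Rooted product: let $V(G)=\{v_1,\ldots,v_n\}$ and let $H$ be a graph with a distinguished vertex (root) $v$. The rooted product $G\overline{\circ}H$ with respect to the root $v$ is obtained by taking $n$ disjoint copies of $H$ and, for each $i$, identifying the vertex $v_i$ of $G$ with the root $v$ of the $i$th copy of $H$. A polynomial $\sum_{k=0}^n c_kx^k$ with nonnegative coefficients is log-concave if $c_k^2\ge c_{k-1}c_{k+1}$ for all $1\le k\le n-1$. Notation: $ab$ denotes the edge joining vertices $a$ and $b$. (So in $T$ the vertex $3$ has neighbours $1,5,2$, and $4$ is a leaf attached to $2$; in $T_1$ the vertex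 $c$ has neighbours $1,5,2$, followed by the path $2,3,4$.) *)

(* Defs.v *)
From HB Require Import structures.
From mathcomp Require Import all_boot all_order all_algebra.
From mathcomp Require Import complex reals.

Set Implicit Arguments.
Unset Strict Implicit.
Unset Printing Implicit Defensive.

Import Order.TTheory GRing.Theory Num.Theory.

Local Open Scope ring_scope.

Record sgraph := SGraph {
  vertex :> finType;
  adj : rel vertex;
  adj_sym : symmetric adj;
  adj_irr : irreflexive adj
}.

Definition independent (G : sgraph) (S : {set G}) : bool :=
  [forall x in S, forall y in S, ~~ adj x y].

Definition indep_num (G : sgraph) : nat :=
  \max_(S : {set G} | independent S) #|S|.

Definition indep_count (G : sgraph) (k : nat) : nat :=
  #|[set S : {set G} | independent S && (#|S| == k)]|.

Definition indep_poly (R : nzRingType) (G : sgraph) : {poly R} :=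
  \poly_(k < (indep_num G).+1) (indep_count G k)%:R.

(* The vertex (u, a) is vertex a of the copy of H attached to u; identifying
   u with the root of its copy makes (u, r) play the role of u. *)
Definition rooted_adj (G H : sgraph) (r : H) : rel (G * H)%type :=
  fun p q => (p.1 == q.1) && adj p.2 q.2
          || [&& p.2 == r, q.2 == r & adj p.1 q.1].

Lemma rooted_adj_sym (G H : sgraph) (r : H) : symmetric (@rooted_adj G H r).
Proof.
move=> p q; rewrite /rooted_adj eq_sym (adj_sym p.2) (adj_sym p.1).
by rewrite [in RHS]andbCA.
Qed.

Lemma rooted_adj_irr (G H : sgraph) (r : H) : irreflexive (@rooted_adj G H r).
Proof. by move=> p; rewrite /rooted_adj !adj_irr !andbF. Qed.

Definition rooted_product (G H : sgraph) (r : H) : sgraph :=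
  SGraph (@rooted_adj_sym G H r) (@rooted_adj_irr G H r).

(* [label i] is the name, in 1, ..., n, of the vertex i : 'I_n. *)
Definition label (n : nat) (i : 'I_n) : nat := i.+1.

Definition edges_adj (n : nat) (E : seq (nat * nat)) : rel 'I_n :=
  fun i j => (i != j) &&
    (((label i, label j) \in E) || ((label j, label i) \in E)).

Lemma edges_adj_sym (n : nat) (E : seq (nat * nat)) :
  symmetric (@edges_adj n E).
Proof. by move=> i j; rewrite /edges_adj eq_sym orbC. Qed.

Lemma edges_adj_irr (n : nat) (E : seq (nat * nat)) :
  irreflexive (@edges_adj n E).
Proof. by move=> i; rewrite /edges_adj eqxx. Qed.

Definition edges_graph (n : nat) (E : seq (nat * nat)) : sgraph :=
  SGraph (@edges_adj_sym n E) (@edges_adj_irr n E).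

Definition T : sgraph :=
  edges_graph 5 [:: (1, 3); (5, 3); (3, 2); (2, 4)]%N.

(* The vertex called c has label 6. *)
Definition T1 : sgraph :=
  let c := 6%N in
  edges_graph 6 [:: (1, c); (5, c); (c, 2); (2, 3); (3, 4)]%N.

Definition only_real_zeros (R : realType) (p : {poly R}) : Prop :=
  forall z : R[i], root (map_poly (real_complex R) p) z -> z \is Num.real.

(* [(size p).-1] is the degree of p, so k ranges over 1 <= k <= deg p - 1. *)
Definition log_concave (R : realType) (p : {poly R}) : Prop :=
  (forall k : nat, 0 <= p`_k) /\
  (forall k : nat, (1 <= k)%N -> (k <= (size p).-1 - 1)%N ->
     p`_(k.-1) * p`_(k.+1) <= p`_k ^+ 2).

(* Main.v *)
Require Import Defs.
From mathcomp Require Import all_boot all_order all_algebra.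
From mathcomp Require Import complex reals.
From mathcomp Require Import zify ring lra.

Set Implicit Arguments.
Unset Strict Implicit.
Unset Printing Implicit Defensive.

Import Order.TTheory GRing.Theory Num.Theory.

(** Let n be the number of vertices of G, let r be the root of H, and put
    A = I(H - r; x) and C = x I(H - N[r]; x).  An independent set of the rooted
    product is an independent set U of G together with, in each copy of H, an
    independent set that contains the root exactly when the copy is attached to
    a vertex of U.  Hence its independence polynomial is the sum over U of
    C^|U| A^(n - |U|), which is A^n I(G; C / A)
    ([indep_poly_rooted_product]).

    Since I(G; x) has nonnegative coefficients and constant term 1, its zeros,
    being real, are negative, and it is a product of factors 1 + a x with
    a > 0.  There are at most n of them; allowing a = 0, there are exactly n
    ([indep_poly_split]).  Substituting C / A and clearing denominators, the
    rooted product has the independence polynomial prod_a (A + a C)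
    ([indep_poly_rooted_product_prod]).  What remains concerns the single
    polynomial A + a C, of degree at most 4, for each a >= 0.

    For T rooted at 1, 2 or 3, A + a C is 1 + x times a quadratic with
    nonnegative discriminant ([rooted_factor_T_real]), so that all zeros of the
    product are real.  In the remaining cases A + a C may have nonreal zeros,
    but its coefficients are log-concave without internal zeros
    ([rooted_factor_T_tp2], [rooted_factor_T1_tp2]).  Such sequences are the
    ones whose Toeplitz matrix has nonnegative 2 x 2 minors, and this property
    passes to products by the Cauchy-Binet formula ([tp2M]). *)

(** * The independence polynomial of a rooted product *)

Section IndependencePolynomial.

Local Open Scope ring_scope.

Variable R : comNzRingType.

(** Summing over sets rather than sizes lets independent sets be reindexed
    and factored vertex by vertex. *)
Lemma indep_poly_sum (G : sgraph) :
  indep_poly R G = \sum_(S : {set G} | independent S) 'X^#|S|.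
Proof.
apply/polyP=> k; rewrite coef_poly coef_sum.
have -> : \sum_(S : {set G} | independent S) ('X^#|S|)`_k
    = (indep_count G k)%:R :> R.
  rewrite (eq_bigr (fun S : {set G} => (#|S| == k)%:R)) => [|S _]; last first.
    by rewrite coefXn eq_sym.
  rewrite -natr_sum /indep_count -sum1_card big_mkcond /=.
  rewrite [in RHS]big_mkcond /=; congr _%:R.
  by apply: eq_bigr => S _; rewrite inE; case: independent; case: eqP.
case: ltnP => // lt_k; rewrite /indep_count (_ : [set S | _] = set0) ?cards0 //.
apply/setP=> S; rewrite !inE; apply/negP => /andP[indS /eqP cardS].
have := @leq_bigmax_cond {set G} _ (fun A : {set G} => #|A|) S indS.
by rewrite cardS leqNgt -/(indep_num G) lt_k.
Qed.

(** For b = false this is I(H - r), and for b = true it is x I(H - N[r]). *)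
Definition rooted_poly (H : sgraph) (r : H) (b : bool) : {poly R} :=
  \sum_(S : {set H} | independent S && ((r \in S) == b)) 'X^#|S|.

(** A vertex set of a rooted product is the same thing as a choice, for each
    vertex u of G, of its trace f u on the copy of H attached to u. *)
Definition slices_set (G H : sgraph) (f : {ffun G -> {set H}}) : {set G * H} :=
  [set p | p.2 \in f p.1].

Lemma slices_set_bij (G H : sgraph) : bijective (@slices_set G H).
Proof.
exists (fun S : {set G * H} => [ffun u => [set a | (u, a) \in S]]) => [f|S].
  by apply/ffunP=> u; rewrite ffunE; apply/setP=> a; rewrite !inE.
by apply/setP=> -[u a]; rewrite !inE ffunE inE.
Qed.

Lemma card_slices_set (G H : sgraph) (f : {ffun G -> {set H}}) :
  #|slices_set f| = (\sum_u #|f u|)%N.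
Proof.
rewrite -sum1_card (eq_bigr (fun u => \sum_(a in f u) 1)%N) => [|u _].
  by rewrite pair_big_dep /=; apply: eq_bigl => -[u a]; rewrite inE.
by rewrite sum1_card.
Qed.

Lemma independent_slices (G H : sgraph) (r : H) (f : {ffun G -> {set H}}) :
  independent (slices_set f : {set rooted_product G r}) =
  independent [set u | r \in f u] && [forall u, independent (f u)].
Proof.
apply/idP/andP => [indf|[indU indf]].
  have {}indf (p q : rooted_product G r) :
      p \in slices_set f -> q \in slices_set f -> ~~ adj p q.
    by move=> Sp Sq; have /forall_inP/(_ p Sp)/forall_inP/(_ q Sq) := indf.
  split.
    apply/forall_inP=> u; rewrite inE => fu; apply/forall_inP=> w; rewrite inE.
    move=> fw; have := indf (u, r) (w, r); rewrite !inE /= => /(_ fu fw).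
    by rewrite /rooted_adj /= eqxx adj_irr andbF.
  apply/forallP=> u; apply/forall_inP=> a fa; apply/forall_inP=> b fb.
  have := indf (u, a) (u, b); rewrite !inE /= => /(_ fa fb).
  by rewrite /rooted_adj /= eqxx adj_irr !andbF orbF.
apply/forall_inP=> -[u a]; rewrite inE /= => fa.
apply/forall_inP=> -[w b]; rewrite inE /= => fb.
rewrite /rooted_adj /= negb_or; apply/andP; split.
  apply/negP=> /andP[/eqP uw ab]; rewrite -uw in fb.
  have /forallP/(_ u)/forall_inP/(_ a fa)/forall_inP/(_ b fb) := indf.
  by rewrite ab.
apply/negP=> /and3P[/eqP ar /eqP br uw].
have /forall_inP/(_ u)/[!inE] := indU.
rewrite -{1}ar fa => /(_ isT)/forall_inP/(_ w)/[!inE].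
by rewrite -{1}br fb uw => /(_ isT).
Qed.

(** Group the independent sets by the set U of the vertices of G that they
    contain.  Once U is fixed, the traces on the copies of H are chosen
    independently of each other, so the sum over them factors: a copy whose
    root lies in U contributes [rooted_poly r true], any other copy
    contributes [rooted_poly r false]. *)
Lemma indep_poly_rooted_product (G H : sgraph) (r : H) :
  indep_poly R (rooted_product G r) =
  \sum_(U : {set G} | independent U)
    rooted_poly r true ^+ #|U| * rooted_poly r false ^+ (#|G| - #|U|).
Proof.
rewrite indep_poly_sum (reindex (@slices_set G H)) /=; last first.
  exact/onW_bij/slices_set_bij.
under eq_bigl do rewrite independent_slices.
under eq_bigr do rewrite card_slices_set -prodrXr.
rewrite (partition_big (fun f : {ffun G -> {set H}} => [set u | r \in f u])
  (@independent G)) => [|f /andP[]//] /=.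
apply: eq_bigr => U indU.
transitivity (\prod_(u : G)
    \sum_(S : {set H} | independent S && ((r \in S) == (u \in U)))
      ('X^#|S| : {poly R})).
  rewrite bigA_distr_big_dep /=; apply: eq_bigl => f.
  apply/andP/familyP => [[/andP[_ /forallP indf] /eqP <-] u|famf].
    by rewrite unfold_in /= indf inE eqxx.
  have -> : [set u | r \in f u] = U.
    apply/setP=> u; rewrite inE; have := famf u.
    by rewrite unfold_in /= => /andP[_ /eqP].
  rewrite indU eqxx; split=> //; apply/forallP=> u.
  by have := famf u; rewrite unfold_in /= => /andP[].
rewrite (bigID (mem U)) /=; congr (_ * _).
  rewrite -prodr_const; apply: eq_bigr => u uU; rewrite uU.
  by apply: eq_bigl => S.
have -> : (#|G| - #|U|)%N = #|~: U| by rewrite -(cardsC U) addKn.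
rewrite -prodr_const; apply: eq_big => [u|u uU]; first by rewrite inE.
by rewrite (negbTE uU).
Qed.

End IndependencePolynomial.

(** * Factoring through the roots of I(G) *)

Section Homogenization.

Local Open Scope ring_scope.

Variable R : comNzRingType.

(** The homogeneous form of degree n attached to p, evaluated at (C, A); this
    is A^n p(C / A) without the division. *)
Definition homogenize (n : nat) (p C A : {poly R}) : {poly R} :=
  \sum_(k < n.+1) p`_k *: (C ^+ k * A ^+ (n - k)).

Lemma homogenize_mul_linear (n : nat) (p C A : {poly R}) (a : R) :
    (size p <= n.+1)%N ->
  homogenize n.+1 (p * (1 + a *: 'X)) C A = homogenize n p C A * (A + a *: C).
Proof.
move=> le_p; have pn : p`_n.+1 = 0 by rewrite nth_default.
have coefE k : (p * (1 + a *: 'X))`_k = p`_k + a * (p * 'X)`_k.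
  by rewrite mulrDr mulr1 -scalerAr coefD coefZ.
rewrite /homogenize.
under eq_bigr do rewrite coefE scalerDl.
rewrite big_split /= mulrDr; congr (_ + _).
  rewrite big_ord_recr /= pn scale0r addr0 mulr_suml.
  apply: eq_bigr => k _; rewrite -scalerAl -mulrA -exprSr subSn //.
  by rewrite -ltnS.
rewrite big_ord_recl coefMX eqxx mulr0 scale0r add0r mulr_suml.
apply: eq_bigr => k _; rewrite lift0 coefMX /= subSS -scalerAl -scalerAr.
rewrite scalerA; congr (_ *: _); first exact: mulrC.
by rewrite exprSr mulrAC.
Qed.

(** Factors 1 + aX rather than X - x: a factor with a = 0 is trivial, so the
    number of factors can be raised at will. *)
Definition linear_prod (s : seq R) : {poly R} := \prod_(a <- s) (1 + a *: 'X).

Lemma size_linear_prod (s : seq R) :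
  (size (linear_prod s) <= (size s).+1)%N.
Proof.
elim: s => [|a s IHs]; first by rewrite /linear_prod big_nil size_poly1.
rewrite /linear_prod big_cons -/(linear_prod s).
apply: leq_trans (size_polyMleq _ _) _.
have size_lin : (size (1 + a *: 'X : {poly R})%R <= 2)%N.
  apply: leq_trans (size_polyD _ _) _; rewrite geq_max size_poly1 /=.
  by apply: leq_trans (size_scale_leq _ _) _; rewrite size_polyX.
by move: (leq_add size_lin IHs) => /=; lia.
Qed.

Lemma homogenize_prod (s : seq R) (C A : {poly R}) :
  homogenize (size s) (linear_prod s) C A =
  \prod_(a <- s) (A + a *: C).
Proof.
elim: s => [|a s IHs].
  rewrite /homogenize /linear_prod !big_nil big_ord1 coef1 scale1r.
  by rewrite !expr0 mulr1.
rewrite /linear_prod !big_cons -/(linear_prod s) mulrC.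
rewrite homogenize_mul_linear ?size_linear_prod // IHs.
by rewrite mulrC.
Qed.

Lemma indep_poly_homogenize (G : sgraph) (C A : {poly R}) :
  \sum_(U : {set G} | independent U) C ^+ #|U| * A ^+ (#|G| - #|U|) =
  homogenize #|G| (indep_poly R G) C A.
Proof.
rewrite /homogenize indep_poly_sum.
under [RHS]eq_bigr do rewrite coef_sum scaler_suml.
rewrite exchange_big /=; apply: eq_bigr => U _.
have ltU : (#|U| < #|G|.+1)%N by rewrite ltnS max_card.
rewrite (bigD1 (Ordinal ltU)) //= coefXn eqxx scale1r big1 ?addr0 // => k.
by rewrite -val_eqE /= coefXn => /negPf ->; rewrite scale0r.
Qed.

(** The polynomial A + aC is what a single copy of H contributes to the rooted
    product once I(G) has been split into the factors 1 + aX. *)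
Definition rooted_factor (H : sgraph) (r : H) (a : R) : {poly R} :=
  rooted_poly R r false + a *: rooted_poly R r true.

(** The independence polynomial of the rooted product is the homogeneous form
    of I(G) at C = x I(H - N[r]) and A = I(H - r), and homogenizing is
    multiplicative.  There must be exactly one factor per vertex of G, since
    each vertex carries a copy of H. *)
Lemma indep_poly_rooted_product_prod (G H : sgraph) (r : H) (s : seq R) :
    size s = #|G| -> indep_poly R G = linear_prod s ->
  indep_poly R (rooted_product G r) = \prod_(a <- s) rooted_factor r a.
Proof.
move=> size_s Gs; rewrite indep_poly_rooted_product indep_poly_homogenize Gs.
by rewrite -size_s homogenize_prod.
Qed.

End Homogenization.

(** * Polynomials with only real zeros *)

Section RealZeros.

Local Open Scope ring_scope.

Variable R : realType.

Lemma root_linear (S : fieldType) (c z : S) :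
  root (1 + c *: 'X) z -> z = - c^-1.
Proof.
rewrite /root !hornerE => /eqP cz; have c0 : c != 0.
  by apply/eqP=> c0; move: cz; rewrite c0 mul0r addr0 => /eqP; rewrite oner_eq0.
by apply: (mulfI c0); rewrite mulrN mulfV // -(addKr 1 (c * z)) cz addr0.
Qed.

Lemma only_real_zeros_linear_prod (s : seq R) :
  only_real_zeros (linear_prod s).
Proof.
move=> z; rewrite /linear_prod rmorph_prod /=.
elim: s => [|c s IHs]; first by rewrite big_nil (negPf (root1 _)).
rewrite big_cons rootM => /orP[|/IHs//].
rewrite rmorphD rmorph1 /= map_polyZ map_polyX => /root_linear ->.
by rewrite -fmorphV -rmorphN; apply/complex_realP; exists (- c^-1).
Qed.

(** Over R[i] the polynomial splits, and its zeros x are real.  None of them is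
    nonnegative, because p(x) >= p(0) = 1 for x >= 0; hence X - x can be
    rescaled to 1 + aX with a = - 1 / x > 0. *)
Lemma only_real_zeros_split (p : {poly R}) :
    only_real_zeros p -> p`_0 = 1 -> (forall k, 0 <= p`_k) ->
  exists2 s : seq R, all (fun a => 0 <= a) s & p = linear_prod s.
Proof.
move=> real_p p0 p_ge0.
have [r Dr] := closed_field_poly_normal (map_poly (real_complex R) p).
have nz_p : p != 0.
  by apply: contra_eq_neq p0 => ->; rewrite coef0 eq_sym oner_eq0.
have real_r z : z \in r -> z \is Num.real.
  move=> rz; apply: real_p; rewrite Dr rootZ ?root_prod_XsubC //.
  by rewrite lead_coef_eq0 map_poly_eq0.
pose t := map (@complex.Re R) r.
have Dp : p = lead_coef p *: \prod_(x <- t) ('X - x%:P).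
  apply: (map_poly_inj (real_complex R)); rewrite Dr lead_coef_map /= map_polyZ.
  congr (_ *: _); rewrite rmorph_prod big_map; apply: eq_big_seq => z rz /=.
  by rewrite rmorphB /= map_polyX map_polyC /= RRe_real ?real_r.
have t_lt0 x : x \in t -> x < 0.
  move=> tx; rewrite ltNge; apply/negP=> x_ge0.
  have : p.[x] = 0.
    by apply/rootP; rewrite Dp rootZ ?lead_coef_eq0 // root_prod_XsubC.
  apply/eqP; rewrite gt_eqF // (horner_coef_wide x (leqnSn _)) big_ord_recl p0.
  rewrite mulr1 ltr_pwDl // sumr_ge0 // => i _.
  by rewrite mulr_ge0 ?exprn_ge0.
exists [seq - x^-1 | x <- t].
  by apply/allP=> _ /mapP[x /t_lt0 x_lt0 ->]; rewrite oppr_ge0 invr_le0 ltW.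
have lead_prod : lead_coef p * \prod_(x <- t) (- x) = 1.
  rewrite -[RHS]p0 -horner_coef0 [in RHS]Dp hornerZ horner_prod; congr (_ * _).
  by apply: eq_bigr => x _; rewrite !hornerE.
have -> : linear_prod [seq - x^-1 | x <- t] =
    \prod_(x <- t) ((- x)^-1 *: ('X - x%:P)).
  rewrite /linear_prod big_map; apply: eq_big_seq => x /t_lt0 x_lt0.
  rewrite scalerBr -[_ *: x%:P]mul_polyC -polyCM invrN mulNr mulVf ?lt_eqF //.
  by rewrite polyCN opprK addrC.
rewrite scaler_prod [LHS]Dp prodfV; congr (_ *: _).
by rewrite (mulr1_eq (etrans (mulrC _ _) lead_prod)).
Qed.

Lemma only_real_zerosM (p q : {poly R}) :
  only_real_zeros p -> only_real_zeros q -> only_real_zeros (p * q).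
Proof.
by move=> p_real q_real z; rewrite rmorphM rootM => /orP[/p_real|/q_real].
Qed.

Lemma only_real_zeros_prod (I : eqType) (s : seq I) (F : I -> {poly R}) :
  (forall i, i \in s -> only_real_zeros (F i)) ->
  only_real_zeros (\prod_(i <- s) F i).
Proof.
move=> realF; rewrite big_seq.
apply: big_ind => //; last exact: only_real_zerosM.
by move=> z; rewrite rmorph1 (negPf (root1 _)).
Qed.

Lemma only_real_zeros_quadratic (b c : R) :
  4 * c <= b ^+ 2 -> only_real_zeros (1 + b *: 'X + c *: 'X^2).
Proof.
move=> disc_ge0; pose d := Num.sqrt (b ^+ 2 - 4 * c).
have dd : d ^+ 2 = b ^+ 2 - 4 * c by rewrite sqr_sqrtr ?subr_ge0.
have -> : 1 + b *: 'X + c *: 'X^2 = linear_prod [:: (b + d) / 2; (b - d) / 2].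
  have -> : c = (b + d) / 2 * ((b - d) / 2) by lra.
  have {1}-> : b = (b + d) / 2 + (b - d) / 2 by lra.
  rewrite /linear_prod !big_cons big_nil -!mul_polyC polyCD polyCM.
  ring.
exact: only_real_zeros_linear_prod.
Qed.

End RealZeros.

(** * Splitting the independence polynomial *)

Section Splitting.

Local Open Scope ring_scope.

Variables (R : realType) (G : sgraph).

Lemma coef_indep_poly_ge0 (k : nat) : 0 <= (indep_poly R G)`_k.
Proof. by rewrite coef_poly; case: ifP. Qed.

Lemma coef0_indep_poly : (indep_poly R G)`_0 = 1.
Proof.
rewrite coef_poly /= /indep_count (_ : [set S | _] = [set set0]) ?cards1 //.
apply/setP=> S; rewrite !inE cards_eq0 andbC; case: eqP => //= ->.
by apply/forall_inP=> x; rewrite inE.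
Qed.

Lemma size_indep_poly : (size (indep_poly R G) <= #|G|.+1)%N.
Proof.
apply: leq_trans (size_poly _ _) _; rewrite ltnS.
by apply/bigmax_leqP=> S _; apply: max_card.
Qed.

(** The vertices of G that exceed the degree of I(G) are accounted for by
    factors with a = 0. *)
Lemma indep_poly_split : only_real_zeros (indep_poly R G) ->
  exists s : seq R, [/\ size s = #|G|, all (fun a => 0 <= a) s
    & indep_poly R G = linear_prod s].
Proof.
case/only_real_zeros_split=> [||s0 s0_ge0 Ds0].
- exact: coef0_indep_poly.
- exact: coef_indep_poly_ge0.
(* Discarding the zeros of s0 makes its length the degree of I(G), which is at
   most the number of vertices; the list is then padded with zeros. *)
pose s := [seq a <- s0 | a != 0].
have Ds : indep_poly R G = linear_prod s.
  rewrite Ds0 /linear_prod /s big_filter [LHS](bigID (fun a => a != 0)) /=.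
  rewrite [X in _ * X]big1 ?mulr1 // => a /negPn/eqP ->.
  by rewrite scale0r addr0.
have size_s : size (indep_poly R G) = (size s).+1.
  rewrite Ds /linear_prod.
  have : all (fun a => a != 0) s by rewrite /s filter_all.
  elim: (s) => [|a t IHt] /=; first by rewrite big_nil size_poly1.
  case/andP=> a0 /IHt {}IHt; rewrite big_cons.
  have sz2 : size (1 + a *: 'X : {poly R})%R = 2%N.
    by rewrite addrC size_polyDl size_scale // ?size_polyX ?size_poly1.
  by rewrite size_mul -?size_poly_eq0 ?sz2 ?IHt.
exists (s ++ nseq (#|G| - size s) 0); split.
- by rewrite size_cat size_nseq subnKC // -ltnS -size_s size_indep_poly.
- rewrite all_cat all_nseq lexx orbT andbT.
  by apply/allP=> a; rewrite mem_filter => /andP[_ /(allP s0_ge0)].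
- rewrite /linear_prod big_cat big_nseq /= scale0r addr0 iter_mulr_1.
  by rewrite expr1n mulr1 -/(linear_prod s).
Qed.

End Splitting.

(** * Total positivity of order two and log-concavity *)

Section TotalPositivity.

Local Open Scope ring_scope.

Variable R : realFieldType.

(** The coefficients form a Polya frequency sequence of order 2: every 2 x 2
    minor of the Toeplitz matrix p_(j - i) is nonnegative.  Log-concavity alone
    is not stable under products (1 + X^3 is log-concave, while its product
    with 1 + X + X^2 + X^3 is not); these minors also forbid internal zeros,
    and are stable. *)
Definition tp2 (p : {poly R}) : Prop :=
  (forall k, 0 <= p`_k) /\
  (forall i j d, (i <= j)%N -> p`_i * p`_(j + d) <= p`_(i + d) * p`_j).

Lemma tp2_1 : tp2 1.
Proof.
split=> [k|i j d]; first by rewrite coef1 ler0n.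
rewrite !coef1; case: i j d => [|i] [|j] [|d] //=.
all: by rewrite ?mulr1 ?mulr0 ?mul0r ?mul1r.
Qed.

(** The difference of the two sides is half the sum over (k, l) of
    (x_k y_l - x_l y_k) (u_k w_l - u_l w_k), by the Binet-Cauchy identity, and
    the two brackets always have the same sign. *)
Lemma binet_cauchy_le (N : nat) (x y u w : 'I_N -> R) :
    (forall k l : 'I_N, (k <= l)%N -> x l * y k <= x k * y l) ->
    (forall k l : 'I_N, (k <= l)%N -> w k * u l <= u k * w l) ->
  (\sum_k x k * w k) * (\sum_k y k * u k) <=
  (\sum_k x k * u k) * (\sum_k y k * w k).
Proof.
move=> xy uw; rewrite -subr_ge0 !big_distrlr /=.
set lhs := \sum_i _; set rhs := \sum_i _.
have lhsC : lhs = \sum_i \sum_j x j * u j * (y i * w i).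
  by rewrite /lhs exchange_big.
have rhsC : rhs = \sum_i \sum_j x j * w j * (y i * u i).
  by rewrite /rhs exchange_big.
(* Adding the sum to its transpose produces the antisymmetrized summand. *)
suff : 0 <= (lhs - rhs) + (lhs - rhs) by lra.
rewrite {2}lhsC {2}rhsC -!sumrB -big_split sumr_ge0 //= => k _.
rewrite -!sumrB -big_split sumr_ge0 //= => l _.
have -> : x k * u k * (y l * w l) - x k * w k * (y l * u l) +
    (x l * u l * (y k * w k) - x l * w l * (y k * u k)) =
    (x k * y l - x l * y k) * (u k * w l - w k * u l) by ring.
case: (leqP k l) => [kl|/ltnW lk].
  by rewrite mulr_ge0 // subr_ge0 ?xy ?uw.
by rewrite mulr_le0 // subr_le0 ?xy // mulrC [leRHS]mulrC uw.
Qed.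

Lemma coefM_widen (p q : {poly R}) (n N : nat) : (n <= N)%N ->
  (p * q)`_n = \sum_(k < N.+1) p`_k * (if (k <= n)%N then q`_(n - k) else 0).
Proof.
move=> le_nN.
rewrite coefM (big_ord_widen N.+1 (fun k => p`_k * q`_(n - k))) //.
rewrite big_mkcond; apply: eq_bigr => k _ /=; rewrite ltnS.
by case: ifP => //; rewrite mulr0.
Qed.

(** The minors of the Toeplitz matrix of p q are sums of products of minors
    of those of p and q.  The minor at hand is the one with rows 0 and n - m,
    and columns n and n + d. *)
Lemma tp2M (p q : {poly R}) : tp2 p -> tp2 q -> tp2 (p * q).
Proof.
move=> [p_ge0 p_tp] [q_ge0 q_tp]; split=> [k|m n d le_mn].
  by rewrite coefM sumr_ge0 // => i _; rewrite mulr_ge0.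
(* Shifting p by e gives the second row, so that both rows of the minor use
   the same two columns. *)
pose e := (n - m)%N; pose y := 'X^e * p.
have yE i : (p * q)`_i = (y * q)`_(i + e).
  by rewrite -mulrA coefXnM ltnNge leq_addl addnK.
rewrite !(yE m) (yE (m + d)%N).
have -> : (m + e = n)%N by rewrite subnKC.
have -> : (m + d + e = n + d)%N by rewrite addnAC subnKC.
rewrite mulrC [leRHS]mulrC.
rewrite !(@coefM_widen _ _ n (n + d)) ?leq_addr //.
rewrite !(@coefM_widen _ _ (n + d) (n + d)) //.
apply: binet_cauchy_le => k l le_kl.
  rewrite !coefXnM; case: ltnP => [|le_ek].
    by rewrite mulr0 mulr_ge0 //; case: ifP.
  rewrite ltnNge (leq_trans le_ek le_kl) /=.
  have := p_tp (k - e)%N (l - e)%N e (leq_sub2r e le_kl).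
  by rewrite !subnK ?(leq_trans le_ek) // mulrC.
rewrite -[(k <= n + d)%N]ltnS -[(l <= n + d)%N]ltnS !ltn_ord.
case: (leqP l n) => [le_ln|_].
  rewrite (leq_trans le_kl le_ln).
  have := q_tp (n - l)%N (n - k)%N d (leq_sub2l n le_kl).
  rewrite -!addnBAC // ?(leq_trans le_kl le_ln) //.
  by rewrite mulrC [leRHS]mulrC.
by rewrite mulr0 mulr_ge0 //; case: ifP.
Qed.

Lemma tp2_prod (I : eqType) (s : seq I) (F : I -> {poly R}) :
  (forall i, i \in s -> tp2 (F i)) -> tp2 (\prod_(i <- s) F i).
Proof.
move=> tpF; rewrite big_seq.
by apply: big_ind => //; [apply: tp2_1 | apply: tp2M].
Qed.

(** Without internal zeros, log-concavity says that the ratios p_(k+1) / p_k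
    decrease, and a minor compares two products of d such ratios.  The proof
    cross-multiplies, first for d = 1 and then for all d. *)
Lemma log_concave_tp2 (p : {poly R}) :
    (forall k, 0 <= p`_k) -> (forall k, p`_k = 0 -> p`_k.+1 = 0) ->
    (forall k, p`_k * p`_k.+2 <= p`_k.+1 ^+ 2) ->
  tp2 p.
Proof.
move=> p_ge0 p_eq0 p_lc; split=> //.
have tp_step i j : (i <= j)%N -> p`_i * p`_j.+1 <= p`_i.+1 * p`_j.
  move/subnKC <-; elim: (j - i)%N => [|k IHk]; first by rewrite addn0 mulrC.
  rewrite addnS; set l := (i + k)%N in IHk *.
  have [/p_eq0 ->|nz] := eqVneq p`_l.+1 0; first by rewrite mulr0 mulr_ge0.
  have pos : 0 < p`_l.+1 by rewrite lt_def nz p_ge0.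
  rewrite -(ler_pM2r pos).
  have h1 := ler_wpM2r (p_ge0 l.+2) IHk.
  have h2 := ler_wpM2l (p_ge0 i.+1) (p_lc l).
  by lra.
move=> i j d le_ij; elim: d => [|d IHd]; first by rewrite !addn0.
rewrite !addnS.
have [/p_eq0 ->|nz] := eqVneq p`_(j + d) 0; first by rewrite mulr0 mulr_ge0.
have pos : 0 < p`_(j + d) by rewrite lt_def nz p_ge0.
rewrite -(ler_pM2r pos).
have h1 := ler_wpM2r (p_ge0 (j + d).+1) IHd.
have := tp_step (i + d)%N (j + d)%N; rewrite leq_add2r => /(_ le_ij).
move/(ler_wpM2r (p_ge0 j)) => h2.
by lra.
Qed.

(** The strict inequalities exclude internal zeros; c4 may vanish, so that
    cubics are covered too. *)
Lemma quartic_tp2 (p : {poly R}) (c1 c2 c3 c4 : R) :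
    [/\ 0 < c1, 0 < c2, 0 < c3 & 0 <= c4] ->
    [/\ c2 <= c1 ^+ 2, c1 * c3 <= c2 ^+ 2 & c2 * c4 <= c3 ^+ 2] ->
  (forall i, p`_i = [:: 1; c1; c2; c3; c4]`_i) -> tp2 p.
Proof.
move=> [c1_gt0 c2_gt0 c3_gt0 c4_ge0] [lc1 lc2 lc3] Dp.
apply: log_concave_tp2 => k; rewrite !Dp.
- by case: k => [|[|[|[|[|k]]]]] /=; rewrite ?nth_nil // ltW.
- by case: k => [|[|[|[|[|k]]]]] /=; rewrite ?nth_nil //;
    move/eqP; rewrite gt_eqF.
- case: k => [|[|[|[|[|k]]]]] /=.
  all: by rewrite ?nth_nil ?mul1r ?mulr0 ?sqr_ge0.
Qed.

End TotalPositivity.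

Lemma tp2_log_concave (R : realType) (p : {poly R}) : tp2 p -> log_concave p.
Proof.
case=> p_ge0 p_tp; split=> // -[//|k] _ _.
by have := p_tp k k.+1 1%N (leqnSn k); rewrite !addn1 expr2.
Qed.

(** * Enumerating the independent sets of a small graph *)

Section Enumeration.

Local Open Scope ring_scope.

(** Sets over 'I_n do not compute, so the subsets of a concrete graph are
    enumerated as characteristic sequences. *)
Fixpoint masks (n : nat) : seq (seq bool) :=
  if n is n'.+1 then
    [seq false :: m | m <- masks n'] ++ [seq true :: m | m <- masks n']
  else [:: [::]].

Definition mask_set (n : nat) (m : seq bool) : {set 'I_n} :=
  [set i : 'I_n | nth false m i].

Lemma mem_masks (n : nat) (m : seq bool) : (m \in masks n) = (size m == n).
Proof.
elim: n m => [|n IHn] [|b m] //=.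
  by rewrite mem_cat; apply/orP=> -[] /mapP[].
rewrite eqSS -IHn mem_cat; apply/orP/idP => [[] /mapP[t tn [_ ->]] //|mn].
by case: b; [right | left]; apply/mapP; exists m.
Qed.

Lemma masks_uniq (n : nat) : uniq (masks n).
Proof.
elim: n => //= n IHn.
rewrite cat_uniq !map_inj_uniq ?IHn => [|? ? []//|? ? []//].
by rewrite andbT /=; apply/hasPn=> _ /mapP[m _ ->]; apply/mapP=> -[].
Qed.

Lemma perm_mask_set (n : nat) :
  perm_eq (index_enum {set 'I_n}) (map (mask_set n) (masks n)).
Proof.
apply: uniq_perm; first exact: index_enum_uniq.
  rewrite map_inj_in_uniq ?masks_uniq // => m t.
  rewrite !mem_masks => /eqP size_m /eqP size_t /setP eq_mt.
  apply: (@eq_from_nth _ false); first by rewrite size_m size_t.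
  move=> i; rewrite size_m => lt_in.
  by have := eq_mt (Ordinal lt_in); rewrite !inE.
move=> S; rewrite mem_index_enum; apply/esym/mapP.
exists [seq i \in S | i <- enum 'I_n].
  by rewrite mem_masks size_map size_enum_ord.
apply/setP=> i; rewrite inE (nth_map i) ?size_enum_ord //.
by rewrite nth_ord_enum.
Qed.

Lemma card_mask_set (n : nat) (m : seq bool) :
  size m = n -> #|mask_set n m| = count id m.
Proof.
move=> <-; rewrite -sum1_card -sum1_count (big_nth false) big_mkord.
by apply: eq_bigl => i; rewrite inE.
Qed.

Definition mask_independent (n : nat) (E : seq (nat * nat)) (m : seq bool) :=
  all (fun i => all (fun j => ~~ [&& nth false m i, nth false m j, i != j
      & ((i.+1, j.+1) \in E) || ((j.+1, i.+1) \in E)]) (iota 0 n)) (iota 0 n).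

Lemma independent_mask_set (n : nat) (E : seq (nat * nat)) (m : seq bool) :
  independent (mask_set n m : {set edges_graph n E}) = mask_independent n E m.
Proof.
apply/forall_inP/allP => [indm i|indm i].
  rewrite mem_iota /= => lt_i; apply/allP=> j; rewrite mem_iota /= => lt_j.
  apply/negP=> /and4P[mi mj ij Eij].
  have := indm (Ordinal lt_i); rewrite inE => /(_ mi).
  move=> /forall_inP/(_ (Ordinal lt_j)).
  by rewrite inE /= /edges_adj /label /= Eij -val_eqE /= ij => /(_ mj).
rewrite inE => mi; apply/forall_inP=> j; rewrite inE => mj.
have := indm i; rewrite mem_iota /= ltn_ord => /(_ isT) /allP/(_ j).
rewrite mem_iota /= ltn_ord mi mj => /(_ isT) /=.
by rewrite /edges_adj /label -val_eqE.
Qed.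

(** The exponents of [rooted_poly], as a list that evaluates. *)
Definition rooted_sizes (n : nat) (E : seq (nat * nat)) (r : nat) (b : bool) :=
  [seq count id m | m <- masks n
     & mask_independent n E m && (nth false m r == b)].

Lemma rooted_polyE (R : realType) (n : nat) (E : seq (nat * nat))
    (r : edges_graph n E) (b : bool) :
  rooted_poly R r b = \sum_(k <- rooted_sizes n E (r : 'I_n) b) 'X^k.
Proof.
rewrite /rooted_poly (perm_big _ (perm_mask_set n)) big_map big_map big_filter.
rewrite big_seq_cond [RHS]big_seq_cond; apply: eq_big => [m|m].
  by rewrite independent_mask_set inE.
by rewrite mem_masks => /andP[/eqP size_m _]; rewrite card_mask_set.
Qed.

End Enumeration.

(** * The factors contributed by the two trees *)

Ltac compute_sizes :=
  repeat match goal with |- context [rooted_sizes ?n ?E ?r ?b] =>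
    let s := eval vm_compute in (rooted_sizes n E r b) in
    change (rooted_sizes n E r b) with s
  end.

Section Factors.

Local Open Scope ring_scope.

Variable R : realType.

Lemma coef_sum_Xn (s : seq nat) (i : nat) :
  (\sum_(k <- s) 'X^k : {poly R})`_i = (count_mem i s)%:R.
Proof.
rewrite coef_sum -sum1_count natr_sum [RHS]big_mkcond /=.
by apply: eq_bigr => k _; rewrite coefXn eq_sym; case: eqP.
Qed.

Lemma coef_rooted_factor (n : nat) (E : seq (nat * nat)) (r : edges_graph n E)
    (a : R) (i : nat) :
  (rooted_factor r a)`_i =
  (count_mem i (rooted_sizes n E (r : 'I_n) false))%:R
  + a * (count_mem i (rooted_sizes n E (r : 'I_n) true))%:R.
Proof. by rewrite coefD coefZ !rooted_polyE !coef_sum_Xn. Qed.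

Ltac check_quartic :=
  [> by split; lra | by split; nra
   | case=> [|[|[|[|[|?]]]]]; rewrite coef_rooted_factor; compute_sizes;
     rewrite /= ?nth_nil; lra].

(** Each factor is 1 + X times a quadratic with nonnegative discriminant.  For
    the roots 1, 2, 3 the quadratics are 1 + (3 + a) X + 2 a X^2,
    1 + (3 + a) X + (1 + a) X^2 and 1 + (3 + a) X + 2 X^2. *)
Lemma rooted_factor_T_real (v : T) (a : R) :
    label (v : 'I_5) \in [:: 1; 2; 3]%N -> 0 <= a ->
  only_real_zeros (rooted_factor v a).
Proof.
move=> v123 a_ge0.
suff [b [c [disc Dv]]] : exists b c, 4 * c <= b ^+ 2 /\
    rooted_factor v a =
      (1 + 1 *: 'X + 0 *: 'X^2) * (1 + b *: 'X + c *: 'X^2).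
  rewrite Dv; apply: only_real_zerosM; apply: only_real_zeros_quadratic => //.
  by rewrite mulr0 expr1n ler01.
rewrite /rooted_factor !rooted_polyE.
case: v v123 => -[|[|[|//]]] lt_v _ /=; compute_sizes;
  rewrite !big_cons !big_nil.
- exists (3 + a), (2 * a); split; first by nra.
  rewrite -!mul_polyC !polyCD polyCM; ring.
- exists (3 + a), (1 + a); split; first by nra.
  rewrite -!mul_polyC !polyCD; ring.
- exists (3 + a), 2; split; first by nra.
  rewrite -!mul_polyC !polyCD; ring.
Qed.

(** The factor is (1 + 4 X + 3 X^2 + X^3) + a X (1 + 3 X + X^2): its two parts
    come from the stars on {1, 3, 5, 2} and on {1, 3, 5}. *)
Lemma rooted_factor_T_tp2 (v : T) (a : R) :
  label (v : 'I_5) = 4%N -> 0 <= a -> tp2 (rooted_factor v a).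
Proof.
case: v => -[|[|[|[|//]]]] lt_v // _ a_ge0.
apply: (@quartic_tp2 _ _ (4 + a) (3 + 3 * a) (1 + a) 0); check_quartic.
Qed.

(** For each root, the differences in the log-concavity inequalities are
    polynomials in a with nonnegative coefficients. *)
Lemma rooted_factor_T1_tp2 (v : T1) (a : R) :
  label (v : 'I_6) \in [:: 1; 2; 3; 4]%N -> 0 <= a -> tp2 (rooted_factor v a).
Proof.
case: v => -[|[|[|[|//]]]] lt_v _ a_ge0.
- apply: (@quartic_tp2 _ _ (5 + a) (6 + 4 * a) (1 + 4 * a) a); check_quartic.
- apply: (@quartic_tp2 _ _ (5 + a) (7 + 3 * a) (2 + 3 * a) a); check_quartic.
- apply: (@quartic_tp2 _ _ (5 + a) (7 + 3 * a) (4 + a) 1); check_quartic.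
- apply: (@quartic_tp2 _ _ (5 + a) (6 + 4 * a) (2 + 3 * a) a); check_quartic.
Qed.

End Factors.

Theorem proposition4p1 (R : realType) (G : sgraph)
    (hG : only_real_zeros (indep_poly R G)) :
  (forall v : 'I_5,
     (label v \in [:: 1; 2; 3] ->
        only_real_zeros (indep_poly R (@rooted_product G T v))) /\
     (label v = 4 ->
        log_concave (indep_poly R (@rooted_product G T v))))
  /\
  (forall v : 'I_6,
     label v \in [:: 1; 2; 3; 4] ->
       log_concave (indep_poly R (@rooted_product G T1 v))).
Proof.
have [s [size_s s_ge0 Ds]] := indep_poly_split hG.
have prodE (H : sgraph) (r : H) := indep_poly_rooted_product_prod r size_s Ds.
split=> [v|v v1234]; first split=> [v123|v4].
- rewrite prodE; apply: only_real_zeros_prod => a /(allP s_ge0).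
  exact: rooted_factor_T_real.
- rewrite prodE; apply: tp2_log_concave; apply: tp2_prod => a /(allP s_ge0).
  exact: rooted_factor_T_tp2.
- rewrite prodE; apply: tp2_log_concave; apply: tp2_prod => a /(allP s_ge0).
  exact: rooted_factor_T1_tp2.
Qed.
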